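(* Let $G=(V;E)$ be the random graph. Let $\mathscr M$ be a locally closed monoid of mappings $V\to V$ (under composition) which contains the automorphism group $\mathrm{Aut}(G)$. Then at least one of the following holds: (1) $\mathscr M$ contains a constant operation; (2) $\mathscr M$ contains $e_E$; (3) $\mathscr M$ contains $e_N$; (4) $\mathscr M$ equals the smallest locally closed monoid of maps $V\to V$ that contains all permutations of $V$ belonging to $\mathscr M$ (i.e. $\mathscr M$ is generated by the permutations it contains).
   Context: The random graph $G=(V;E)$ is the unique (up to isomorphism) countably infinite graph such that for all finite disjoint $U,U'\subseteq V$ there is $v\in V\setminus(U\cup U')$ adjacent to every vertex of $U$ and to no vertex of $U'$. A monoid $\mathscr M$ of maps $D\to D$ is locally closed if whenever $f:D\to D$ is such that for every finite $A\subseteq D$ some $e\in\mathscr M$ agrees with $f$ on $A$, then $f\in\mathscr M$ (equivalently, $\mathscr M$ is closed in the product topology on $D^D$ with $D$ discrete). $e_E$ denotes a fixed injective map $V\to V$ whose image induces an infinite complete graph in $G$, and $e_N$ a fixed injective map $V\to V$ whose image induces an infinite independent set in $G$ (any two choices of such maps generate the same locally closed monoid together with $\mathrm{Aut}(G)$). *)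

(* Defs.v *)
From mathcomp Require Import all_boot.
From mathcomp Require Import boolp classical_sets functions cardinality.

Set Implicit Arguments.
Unset Strict Implicit.
Unset Printing Implicit Defensive.

Local Open Scope classical_set_scope.
Local Open Scope card_scope.

(* A graph is a loopless undirected one, given by its adjacency relation. *)
Definition random_graph (V : Type) (E : rel V) : Prop :=
  [/\ [set: V] #= [set: nat],
      symmetric E,
      irreflexive E &
      forall U U' : set V, finite_set U -> finite_set U' ->
        U `&` U' = set0 ->
        exists v, [/\ (~` (U `|` U')) v,
                      forall u, U u -> E v u &
                      forall u, U' u -> ~~ E v u]].

Definition Aut (V : Type) (E : rel V) : set (V -> V) :=
  [set f | bijective f /\ {mono f : x y / E x y}].

Definition all_permutations (V : Type) : set (V -> V) := [set f | bijective f].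
Arguments all_permutations V : clear implicits.

Definition monoid_of_maps (D : Type) (M : set (D -> D)) : Prop :=
  M id /\ forall f g, M f -> M g -> M (f \o g).

Definition locally_closed (D : Type) (M : set (D -> D)) : Prop :=
  forall f : D -> D,
    (forall A : set D, finite_set A ->
       exists2 e, M e & forall x, A x -> e x = f x) ->
    M f.

Definition locally_closed_monoid (D : Type) (M : set (D -> D)) : Prop :=
  monoid_of_maps M /\ locally_closed M.

Definition generated_monoid (D : Type) (F : set (D -> D)) : set (D -> D) :=
  smallest (@locally_closed_monoid D) F.

(* [smallest] is an intersection; this checks that it is itself a locally
   closed monoid, hence the least one containing [F]. *)
Lemma generated_monoid_locally_closed (D : Type) (F : set (D -> D)) :
  locally_closed_monoid (generated_monoid F).
Proof.
split; first split.
- by move=> N [[[N1 _] _] _].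
- by move=> f g Ff Fg N NF;
  case: (NF) => -[[_ NM] _] _; apply: NM; [exact: Ff|exact: Fg].
- move=> f Hf N NF; case: (NF) => -[_ NC] _; apply: NC => A finA.
  by have [e Fe eA] := Hf A finA; exists e => //; exact: Fe.
Qed.

Definition infinite_clique (V : Type) (E : rel V) (S : set V) : Prop :=
  infinite_set S /\ forall x y, S x -> S y -> x <> y -> E x y.

Definition infinite_independent_set (V : Type) (E : rel V) (S : set V) : Prop :=
  infinite_set S /\ forall x y, S x -> S y -> ~~ E x y.

(* Main.v *)
Require Import Defs.
From mathcomp Require Import all_boot.
From mathcomp Require Import boolp classical_sets functions cardinality filter.

(* If every map of M can be undone on finite sets by another map of M, a back
   and forth argument extends finite restrictions of maps of M to permutations
   in M, which gives the last alternative.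

   Otherwise some g0 in M cannot be undone on a finite set s.  A tuple has
   finitely many isomorphism types, so every finite A is sent by some g in M to
   a position that no map of M moves irreversibly; an ultrafilter limit of such
   g colours the pairs of V by (equal or not, adjacent or not) after applying g.
   A Ramsey argument then finds, for any finite graph F, an induced copy of F on
   which the colour of a pair is a function phi of its adjacency alone; phi
   depends on the size of F only.  If phi yields "equal", maps of M collapse
   arbitrary finite sets; if phi is constant, they produce cliques or
   independent sets.  If phi is the identity or the complement, choosing F to be
   E or its complement makes some g in M restore the type of s, so that s is
   itself in a reversible position, contradicting the choice of g0.

   The Ramsey statement for finitely many cells U_1, ..., U_n (jointly generic
   subsets of V) uses no structural Ramsey theory: minimising, over all generic
   families, the set of colour profiles that a vertex of U_a can have towards
   refined cells makes one profile psi_a available forever, so it can be fixed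
   before the graph F is chosen.  Ramsey's theorem for pairs then removes the
   dependence of the profile on the cells. *)

Set Implicit Arguments.
Unset Strict Implicit.
Unset Printing Implicit Defensive.

Local Open Scope classical_set_scope.

(** * Back and forth *)

(** Each stage puts the next point of the enumeration into both domain and range. Finite pieces of
    [f] stay inside lists of [G], so whatever [G] guarantees locally, such as being an isomorphism
    or coming from [M], can be read off for [f]. *)
Lemma back_and_forth (V : choiceType) (e : nat -> V)
    (G : seq (V * V) -> Prop) (L0 : seq (V * V)) :
    (forall v, exists n, e n = v) ->
    (forall L, G L -> {in L &, forall p q, (p.1 == q.1) = (p.2 == q.2)}) ->
    (forall L a, G L -> exists b, G ((a, b) :: L)) ->
    (forall L b, G L -> exists a, G ((a, b) :: L)) ->
    G L0 ->
  exists2 f : V -> V, bijective f &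
    forall A : seq V, exists L, [/\ G L, {subset L0 <= L},
      {in L, forall p, f p.1 = p.2} & {in A, forall a, (a, f a) \in L}].
Proof.
move=> eS Gfun forth back GL0.
have step L n : exists L', G L -> [/\ G L', {subset L <= L'},
    exists b, (e n, b) \in L' & exists a, (a, e n) \in L'].
  (* The empty list is a dummy that makes the step total, as [choice] requires. *)
  have [GL|nGL] := EM (G L); last by exists [::].
  have [b Gb] := forth L (e n) GL.
  have [a Ga] := back _ (e n) Gb.
  exists ((a, e n) :: (e n, b) :: L) => _; split => //.
  - by move=> p pL; rewrite !inE pL !orbT.
  - by exists b; rewrite !inE eqxx orbT.
  - by exists a; rewrite !inE eqxx.
have [st stP] := choice (fun p => step p.1 p.2).
pose Ls := fix Ls n := if n is m.+1 then st (Ls m, m) else L0.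
have GLs n : G (Ls n) by elim: n => //= n IH; have [] := stP (Ls n, n) IH.
have LsS n : {subset Ls n <= Ls n.+1} by have [] := stP (Ls n, n) (GLs n).
have Lsub m n : m <= n -> {subset Ls m <= Ls n}.
  elim: n => [|n IH]; first by rewrite leqn0 => /eqP->.
  by rewrite leq_eqVlt => /predU1P[->//|/IH mn p /mn /LsS].
have Lsfun m n p q : p \in Ls m -> q \in Ls n -> (p.1 == q.1) = (p.2 == q.2).
  move=> pm qn; apply: (Gfun _ (GLs (maxn m n))).
    by apply: Lsub pm; exact: leq_maxl.
  by apply: Lsub qn; exact: leq_maxr.
have fP a : exists b, exists n, (a, b) \in Ls n.
  have [n <-] := eS a; have [_ _ [b ?] _] := stP (Ls n, n) (GLs n).
  by exists b, n.+1.
have gP b : exists a, exists n, (a, b) \in Ls n.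
  have [n <-] := eS b; have [_ _ _ [a ?]] := stP (Ls n, n) (GLs n).
  by exists a, n.+1.
have [f {}fP] := choice fP; have [g {}gP] := choice gP.
exists f.
  exists g => x.
    have [m fx] := fP x; have [n gx] := gP (f x).
    by apply/eqP; rewrite (Lsfun _ _ _ _ gx fx) eqxx.
  have [m gx] := gP x; have [n fx] := fP (g x).
  by apply/eqP; rewrite -(Lsfun _ _ _ _ fx gx) eqxx.
have fLs n p : p \in Ls n -> f p.1 = p.2.
  move=> pn; have [m fx] := fP p.1.
  by apply/eqP; rewrite -(Lsfun _ _ _ _ fx pn) eqxx.
move=> A; suff [n nA] : exists n, {in A, forall a, (a, f a) \in Ls n}.
  by exists (Ls n); split => //; [exact: (@Lsub 0) | exact: fLs].
elim: A => [|a A [n IH]]; first by exists 0.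
have [m fa] := fP a; exists (maxn m n) => x; rewrite inE => /predU1P[->|/IH].
  by apply: Lsub fa; exact: leq_maxl.
by apply: Lsub; exact: leq_maxr.
Qed.

Section CountableHomogeneity.
Variables (V : choiceType) (E : rel V).
Hypotheses (symE : symmetric E) (irrE : irreflexive E).
Hypothesis extE : forall (A : seq V) (P : pred V),
  exists2 v, v \notin A & {in A, E v =1 P}.
Variable e : nat -> V.
Hypothesis eS : forall v, exists n, e n = v.

Let partial_iso (L : seq (V * V)) :=
  {in L &, forall p q, (p.1 == q.1) = (p.2 == q.2) /\ E p.1 q.1 = E p.2 q.2}.

Let flip (p : V * V) := (p.2, p.1).

Let flipK : cancel flip flip. Proof. by case. Qed.

Let partial_iso_flip L : partial_iso L -> partial_iso (map flip L).
Proof.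
by move=> LP _ _ /mapP[p pL ->] /mapP[q qL ->]; have [-> ->] := LP p q pL qL.
Qed.

Let partial_iso_forth L a : partial_iso L -> exists b, partial_iso ((a, b) :: L).
Proof.
move=> LP; have [/mapP[p pL ->]|aL] := boolP (a \in map fst L).
  exists p.2; have e12 : (p.1, p.2) = p by case: p {pL}.
  move=> q r; rewrite !inE e12 => qL rL.
  by apply: LP; [case/predU1P: qL => [->|] | case/predU1P: rL => [->|]].
have [b bL bP] := extE (map snd L) (fun y => has (fun p => (p.2 == y) && E a p.1) L).
have bE p : p \in L -> E a p.1 = E b p.2.
  move=> pL; rewrite bP ?map_f//; apply/idP/hasP => [Eap|[q qL /andP[/eqP qp]]].
    by exists p; rewrite // eqxx.
  have [+ _] := LP q p qL pL.
  by rewrite qp eqxx => /eqP ->.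
have bN p : p \in L -> (a == p.1) = (b == p.2).
  move=> pL; case: (a =P p.1) aL => [->|_ _]; first by rewrite map_f.
  by case: (b =P p.2) bL => [->|//]; rewrite map_f.
exists b => p q; rewrite !inE => /predU1P[->|pL] /predU1P[->|qL] /=.
- by rewrite !eqxx !irrE.
- by rewrite bN ?bE.
- by rewrite eq_sym bN// eq_sym symE bE// symE.
- exact: LP.
Qed.

(** Comparing two maps on [s], instead of extending a partial map, allows tuples with repetitions,
    such as images under collapsing maps. *)
Lemma homogeneous (s : seq V) (f g : V -> V) :
    {in s &, forall x y, x <> y ->
      (f x == f y) = (g x == g y) /\ E (f x) (f y) = E (g x) (g y)} ->
  exists2 a, Aut E a & {in s, forall x, a (f x) = g x}.
Proof.
move=> fg; pose L0 := [seq (f x, g x) | x <- s].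
have L0P : partial_iso L0.
  move=> _ _ /mapP[x xs ->] /mapP[y ys ->].
  by case: (eqVneq x y) => [->|/eqP]; [rewrite !eqxx !irrE | exact: fg].
have [| | | |a bija aP] := @back_and_forth V e partial_iso L0 eS.
- by move=> L LP p q pL qL; have [] := LP p q pL qL.
- exact: partial_iso_forth.
- move=> L b /partial_iso_flip /(partial_iso_forth b)[c /partial_iso_flip].
  by rewrite /= (mapK flipK); exists c.
- exact: L0P.
exists a; first split => //.
  move=> x y; have [L [LP _ _ aL]] := aP [:: x; y].
  have xL : (x, a x) \in L by apply: aL; rewrite inE eqxx.
  have yL : (y, a y) \in L by apply: aL; rewrite !inE eqxx orbT.
  by have [_ ] := LP _ _ xL yL.
move=> x xs; have [L [_ L0L aL _]] := aP [::].
by apply: (aL (f x, g x)); apply: L0L; exact: map_f.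
Qed.

Lemma reversible_generated (M : set (V -> V)) :
    locally_closed_monoid M ->
    (forall (s : seq V) g, M g -> exists2 g', M g' & {in s, cancel g g'}) ->
  M = generated_monoid (M `&` all_permutations V).
Proof.
move=> [[M1 MM] MC] rev; rewrite eqEsubset; split; last first.
  by apply: smallest_sub; [split | exact: subIsetl].
move=> f Mf N [[[N1 NM] NC] MN]; apply: NC => A /finite_seqP[s ->].
pose G (L : seq (V * V)) := exists2 g, M g & {in L, forall p, g p.1 = p.2}.
have [| | | |a bija aP] := @back_and_forth V e G [seq (x, f x) | x <- s] eS.
- move=> L [g Mg gL] p q pL qL; rewrite -!gL//.
  have [g' _ gK] := rev [:: p.1; q.1] g Mg.
  rewrite (inj_in_eq (can_in_inj gK))// !inE eqxx ?orbT//.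
- move=> L x [g Mg gL]; exists (g x), g => // p.
  by rewrite inE => /predU1P[->//|/gL].
- move=> L y [g Mg gL]; have [g' Mg' gK] := rev (map fst L) g Mg.
  (* As [g'] takes the range of [L] back to its domain, undoing [g'] there makes [h] agree with [g]
     on the domain, while [h] also sends [g' y] to [y]. *)
  have [h Mh hK] := rev (y :: map snd L) g' Mg'.
  exists (g' y), h => // p; rewrite inE => /predU1P[->|pL] /=.
    by rewrite hK ?inE ?eqxx.
  by rewrite -{1}(gK p.1) ?map_f// (gL p)// hK// inE map_f ?orbT.
- by exists f => // _ /mapP[x _ ->].
exists a; last first.
  move=> x xs; have [L [_ L0L aL _]] := aP [::].
  by apply: (aL (x, f x)); apply: L0L; exact: map_f.
apply: MN; split => //; apply: MC => B /finite_seqP[t ->].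
have [L [[g Mg gL] _ _ aL]] := aP t.
by exists g => // x xt; exact: (gL (x, a x) (aL x xt)).
Qed.

End CountableHomogeneity.

(** * Ramsey's theorem for pairs *)

Lemma pigeonhole_seq (T : Type) (C : finType) (h : T -> C) (n : nat) (s : seq T) :
  n * #|C| < size s -> exists k, n < count (fun x => h x == k) s.
Proof.
apply: contraPP => /forallNP noN; apply/negP; rewrite -leqNgt.
have -> : size s = \sum_k count (fun x => h x == k) s.
  elim: s {noN} => [|x s IHs] /=; first by rewrite big1.
  rewrite IHs big_split -add1n; congr (_ + _) => /=.
  by rewrite (bigD1 (h x))//= eqxx big1 ?addn0// => k /negbTE; rewrite eq_sym => ->.
rewrite mulnC -sum_nat_const leq_sum// => k _.
by rewrite leqNgt; apply/negP; exact: noN.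
Qed.

(** Each chosen head keeps only a large colour class of the rest and carries that colour, so a pair
    is coloured by its earlier member. *)
Lemma end_homogeneous (C : finType) (m : nat) : exists N,
  forall (f : nat -> nat -> C) (s : seq nat), N <= size s ->
    exists u : seq (nat * C), [/\ subseq (map fst u) s, size u = m &
      pairwise (fun p q => f p.1 q.1 == p.2) u].
Proof.
elim: m => [|m [N IH]]; first by exists 0 => f s _; exists [::]; rewrite sub0seq.
exists (N * #|C|).+2 => f [//|a s]; rewrite ltnS => /pigeonhole_seq.
move=> /(_ (f a))[k /ltnW]; rewrite -size_filter => /(IH f)[u [us szu fu]].
exists ((a, k) :: u) => /=; rewrite eqxx szu fu andbT; split => //.
  by apply: subseq_trans us _; exact: filter_subseq.
apply/allP => p pu /=.
by have := mem_subseq us (map_f fst pu); rewrite mem_filter => /andP[].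
Qed.

Lemma ramsey_pairs (C : finType) (n : nat) : exists N,
  forall f : nat -> nat -> C, exists (s : seq nat) (k : C),
    [/\ subseq s (iota 0 N), size s = n & pairwise (fun a b => f a b == k) s].
Proof.
have [N NP] := end_homogeneous C (n * #|C|).+1; exists N => f.
have [|u [us szu fu]] := NP f (iota 0 N); first by rewrite size_iota.
(* A second pigeonhole, on the carried colours, makes the colour of pairs constant. *)
have [|k nk] := @pigeonhole_seq _ _ (@snd nat C) n u; first by rewrite szu.
pose v := [seq p <- u | p.2 == k].
exists (take n (map fst v)), k; split.
- apply: subseq_trans (take_subseq _ _) (subseq_trans _ us).
  exact/map_subseq/filter_subseq.
- by rewrite size_takel// size_map size_filter ltnW.
- apply: subseq_pairwise (take_subseq _ _) _; rewrite pairwise_map.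
  have: pairwise (fun p q => f p.1 q.1 == p.2) v.
    by apply: subseq_pairwise fu; exact: filter_subseq.
  apply: (@sub_in_pairwise _ (fun p => p.2 == k)); last by rewrite filter_all.
  by move=> p q /eqP <-.
Qed.

(** * Canonical copies of finite graphs *)

Section GenericFamilies.
Variables (V : choiceType) (E : rel V).
Hypothesis symE : symmetric E.
Hypothesis extE : forall (A : seq V) (P : pred V),
  exists2 v, v \notin A & {in A, E v =1 P}.

(* Restricting A to the union of the cells is what lets a cell be shrunk to a
   single type over finitely many vertices outside the new family. *)
Definition generic_family (T : Type) (U : T -> set V) :=
  forall (A : seq V) (P : pred V) (t : T), (forall x, x \in A -> exists t', U t' x) ->
    exists v, [/\ U t v, v \notin A & {in A, E v =1 P}].

Lemma generic_familyT (T : Type) : generic_family (fun _ : T => setT).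
Proof. by move=> A P t _; have [v] := extE A P; exists v. Qed.

(** If cutting cell [t0] down to [S] destroys genericity, some type over a finite [A] has no
    realisation there. Shrinking every cell to that type over [A] stays generic and moves cell [t0]
    off [S]. *)
Lemma generic_decide (T : Type) (U : T -> set V) (t0 : T) (S : set V) :
    generic_family U ->
  exists U', [/\ generic_family U', (forall t, U' t `<=` U t) &
    U' t0 `<=` S \/ U' t0 `<=` ~` S].
Proof.
move=> gU; pose R t := [set v | U t v /\ (t = t0 -> S v)].
have [gR|] := EM (generic_family R).
  by exists R; split => //; [move=> t v [] | left=> v [_ /(_ erefl)]].
move=> /existsNP[A] /existsNP[P] /existsNP[t] /not_implyP[AR noR].
have AU x : x \in A -> exists t', U t' x by move=> /AR[t' []]; exists t'.
have tt0 : t = t0.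
  apply: contrapT => tt0; apply: noR.
  by have [v [Uv vA vP]] := gU A P t AU; exists v.
exists (fun t' => [set v | [/\ U t' v, v \notin A & {in A, E v =1 P}]]); split.
- move=> B Q t' BU.
  (* Points of [B] lie in the new cells, hence outside [A], so the two prescriptions do not
     clash. *)
  have [|v [Uv]] := gU (A ++ B) (fun x => if x \in A then P x else Q x) t'.
    by move=> x; rewrite mem_cat => /orP[/AU//|/BU[u [Uu _ _]]]; exists u.
  rewrite mem_cat negb_or => /andP[vA vB] vP; exists v; split => //.
    by split=> // x xA; rewrite vP ?xA// mem_cat xA.
  move=> x xB; rewrite vP ?mem_cat ?xB ?orbT//.
  by have [u [_ /negbTE-> _]] := BU x xB.
- by move=> t' v [].
- by right=> v [Uv vA vP] Sv; apply: noR; exists v; rewrite tt0.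
Qed.

Lemma generic_monochromatic (T C : finType) (h : V -> C) (U : T -> set V) :
    generic_family U ->
  exists U' (psi : T -> C), [/\ generic_family U', (forall t, U' t `<=` U t) &
    forall t v, U' t v -> h v = psi t].
Proof.
move=> gU.
have [U' [gU' U'U dec]] : exists U', [/\ generic_family U', (forall t, U' t `<=` U t) &
    {in enum {: T * C}, forall p, U' p.1 `<=` [set v | h v = p.2] \/
                                  U' p.1 `<=` ~` [set v | h v = p.2]}].
  elim: (enum _) => [|p s [U1 [gU1 U1U dec1]]]; first by exists U; split=> // t; exact: subset_refl.
  have [U2 [gU2 U21 dec2]] := generic_decide p.1 [set v | h v = p.2] gU1.
  exists U2; split => //; first by move=> t v /U21 /U1U.
  move=> q; rewrite inE => /predU1P[->//|/dec1 [] U1q]; [left|right];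
  by move=> v /U21 /U1q.
have inh t : exists v, U' t v.
  by have [//|v []] := gU' [::] xpredT t; exists v.
have [w wP] := choice inh.
exists U', (h \o w); split=> // t v U'v /=.
by case: (dec (t, h (w t))) => [|/(_ v U'v)//|/(_ _ (wP t)) /(_ erefl)]; rewrite ?mem_enum.
Qed.

Section Profiles.
Variables (T C : finType) (c : V -> V -> C).

(* The refined family has two cells (b, true) and (b, false) for each b, so that
   the adjacency of v to cell b can still be chosen after psi is known. *)
Definition attains (U : T -> set V) (a : T) (psi : {ffun T * bool -> C}) :=
  exists2 v, U a v & exists2 U' : T * bool -> set V, generic_family U' &
    forall p w, U' p w -> [/\ U p.1 w, w <> v, E v w = p.2 & c v w = psi p].

Lemma attains_sub (U U' : T -> set V) a psi :
  (forall t, U' t `<=` U t) -> attains U' a psi -> attains U a psi.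
Proof.
move=> U'U [v U'v [W gW WP]]; exists v; first exact: U'U.
by exists W => // p w /WP[/U'U].
Qed.

(** Splitting the cells by adjacency to a fixed [v] stays generic, since [v] can be added to any
    prescribed type; the result is then made monochromatic for [c v]. *)
Lemma attains_exists (U : T -> set V) a :
  generic_family U -> exists psi, attains U a psi.
Proof.
move=> gU; have [//|v [Uv _ _]] := gU [::] xpredT a.
pose W (p : T * bool) := [set w | [/\ U p.1 w, w <> v & E v w = p.2]].
have gW : generic_family W.
  move=> A P p AW.
  have [|w [Uw]] := gU (v :: A) (fun x => if x == v then p.2 else P x) p.1.
    by move=> x; rewrite inE => /predU1P[->|/AW[q []]]; [exists a | exists q.1].
  rewrite inE negb_or => /andP[/eqP wv wA] wP; exists w; split => //.
    by split=> //; rewrite symE wP ?inE eqxx.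
  move=> x xA; rewrite wP ?inE ?xA ?orbT//.
  by have [q [_ /eqP/negbTE-> _]] := AW x xA.
have [W' [psi [gW' W'W W'psi]]] := generic_monochromatic (c v) gW.
exists (finfun psi), v => //; exists W' => // p w W'w.
by have [] := W'W _ _ W'w; split=> //; rewrite ffunE (W'psi p).
Qed.

(* Profiles only disappear when the family shrinks: take U with the fewest. *)
Lemma stable_profiles : exists U (psi : T -> {ffun T * bool -> C}),
  generic_family U /\ forall U', generic_family U' -> (forall t, U' t `<=` U t) ->
    forall a, attains U' a (psi a).
Proof.
pose R (U : T -> set V) := [set x : T * {ffun T * bool -> C} | `[<attains U x.1 x.2>]]%SET.
pose Q n := `[< exists2 U, generic_family U & #|R U| = n >].
have exQ : exists n, Q n.
  by exists #|R (fun=> setT)|; apply/asboolP; exists (fun=> setT) => //; exact: generic_familyT.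
case: (ex_minnP exQ) => n /asboolP[U gU <-] minU.
have [psi psiP] := choice (fun a => attains_exists a gU).
exists U, psi; split=> // U' gU' U'U a.
have sub : R U' \subset R U.
  apply/fintype.subsetP => x; rewrite !finset.in_set !asboolE.
  exact: attains_sub U'U.
have /eqP RE : R U' == R U.
  by rewrite eqEcard sub minU//; apply/asboolP; exists U'.
have : (a, psi a) \in R U by rewrite finset.in_set; exact/asboolP.
by rewrite -RE finset.in_set => /asboolP.
Qed.

End Profiles.

Lemma end_canonical (C : finType) (c : V -> V -> C) (n : nat) :
  exists psi : 'I_n -> {ffun 'I_n * bool -> C}, forall F : rel 'I_n,
    exists v : 'I_n -> V, forall a b : 'I_n, a < b ->
      [/\ v b <> v a, E (v a) (v b) = F a b & c (v a) (v b) = psi a (b, F a b)].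
Proof.
have [U [psi [gU stU]]] := stable_profiles 'I_n c; exists psi => F.
(* Vertices are chosen by increasing index. After the vertex for [a], cell [t] shrinks to its part
   [(t, F a t)], which settles adjacency and colour towards that vertex; stability keeps the later
   profiles attainable. *)
suff: forall s : seq 'I_n, sorted ltn (map val s) ->
    forall U', generic_family U' -> (forall t, U' t `<=` U t) ->
    exists2 v : 'I_n -> V, {in s, forall a, U' a (v a)} &
      {in s &, forall a b : 'I_n, a < b ->
      [/\ v b <> v a, E (v a) (v b) = F a b & c (v a) (v b) = psi a (b, F a b)]}.
  have sS : sorted ltn (map val (enum 'I_n)) by rewrite val_enum_ord iota_ltn_sorted.
  move=> /(_ _ sS U gU)[t|v _ vP]; first exact: subset_refl.
  by exists v => a b; apply: vP; exact: mem_enum.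
elim=> [|a s IH] /= sS U' gU' U'U.
  have inh a : exists v, U' a v by have [//|v []] := gU' [::] xpredT a; exists v.
  by have [v _] := choice inh; exists v.
have [v U'v [W gW WP]] := stU U' gU' U'U a.
have WU' t : W (t, F a t) `<=` U' t by move=> w /WP[].
have [|||u uW uP] := IH _ (fun t => W (t, F a t)).
- exact: path_sorted sS.
- by move=> A P t AW; apply: gW => x /AW[t' ?]; exists (t', F a t').
- by move=> t w /WU' /U'U.
have sa : {in s, forall b : 'I_n, a < b}.
  by move=> b bs; have /allP := order_path_min ltn_trans sS; apply; exact: map_f.
exists (fun b => if b == a then v else u b) => [b|b d].
  rewrite inE => /predU1P[->|bs]; first by rewrite eqxx.
  by case: eqP => [->//|_]; apply: WU'; exact: uW.
have sN b' : b' \in s -> (b' == a) = false.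
  by move=> /sa; apply: contraTF => /eqP->; rewrite ltnn.
rewrite !inE => /predU1P[->|bs] /predU1P[->|ds]; rewrite ?eqxx ?sN ?ltnn//.
- by move=> _; have [] := WP _ _ (uW d ds).
- by move=> /ltnW; rewrite leqNgt sa.
- exact: uP.
Qed.

Lemma canonical_copies (C : finType) (c : V -> V -> C) (A : seq V) :
    (forall x y, c x y = c y x) -> uniq A ->
  exists phi : bool -> C, forall F : rel V, symmetric F ->
    exists i : V -> V, {in A &, forall x y, x <> y ->
      [/\ i x <> i y, E (i x) (i y) = F x y & c (i x) (i y) = phi (F x y)]}.
Proof.
move=> symc uA; have [x0 _ _] := extE [::] xpredT.
have [N NP] := ramsey_pairs {ffun bool -> C} (size A).
have [psi psiP] := end_canonical c N.+1.
(* A pair of indices is coloured by the whole function from adjacency to colour, so homogeneity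
   yields one [phi] before [F] is known. *)
have [s [phi [sN szs]]] := NP (fun a b => [ffun e => psi (inord a) (inord b, e)]).
move=> /(pairwiseP 0) sphi.
have sS : sorted ltn s by apply: subseq_sorted sN (iota_ltn_sorted _ _); exact: ltn_trans.
exists phi => F symF.
(* Indices outside [s] read the default [x0]; only the positions [pos x], which lie in [s], are used
   afterwards. *)
have [v vP] := psiP (fun a b => F (nth x0 A (index (val a) s)) (nth x0 A (index (val b) s))).
pose pos x : 'I_N.+1 := inord (nth 0 s (index x A)).
have posE x : x \in A -> pos x = nth 0 s (index x A) :> nat.
  move=> xA; rewrite inordK// ltnW// ltnS.
  have : nth 0 s (index x A) \in iota 0 N.
    by apply: (mem_subseq sN); rewrite mem_nth// szs index_mem.
  by rewrite mem_iota.
have posK x : x \in A -> nth x0 A (index (val (pos x)) s) = x.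
  move=> xA; rewrite /= posE// index_uniq ?nth_index ?szs ?index_mem//.
  by apply: (@sorted_uniq _ ltn) sS; [exact: ltn_trans | exact: ltnn].
exists (v \o pos).
have main x y : x \in A -> y \in A -> index x A < index y A ->
  [/\ v (pos x) <> v (pos y), E (v (pos x)) (v (pos y)) = F x y
    & c (v (pos x)) (v (pos y)) = phi (F x y)].
  move=> xA yA xy; have [] := vP (pos x) (pos y).
    by rewrite !posE// (sorted_ltn_nth ltn_trans)// inE szs index_mem.
  rewrite !posK// => vxy -> ->; split => //; first exact/nesym.
  have xs : index x A \in gtn (size s) by rewrite inE szs index_mem.
  have ys : index y A \in gtn (size s) by rewrite inE szs index_mem.
  by have /eqP <- := sphi _ _ xs ys xy; rewrite ffunE.
move=> x y xA yA xy /=; case: (ltngtP (index x A) (index y A)) => [|yx|/index_inj].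
- exact: main.
- have [? ? ?] := main y x yA xA yx.
  by split; [exact/nesym | rewrite symE symF | rewrite symc symF].
- by move=> /(_ x xA yA).
Qed.

End GenericFamilies.

(** * Monoids with an irreversible map *)

(** An ultrafilter on lists that contains every cone of superlists decides each [r A i]; finitely
    many decisions and a cone have a common member. *)
Lemma ultralimit (V I : eqType) (r : seq V -> I -> bool) : exists c : I -> bool,
  forall (B : seq V) (X : seq I), exists2 A : seq V, {subset B <= A} & {in X, r A =1 c}.
Proof.
pose F := filter_from [set: seq V] (fun B => [set A : seq V | {subset B <= A}]).
have FF : ProperFilter F.
  apply: filter_from_proper => [|B _]; last by exists B => /=.
  apply: filter_from_filter => [|B C _ _]; first by exists [::].
  exists (B ++ C) => // A BCA.
  by split=> x xB; apply: BCA; rewrite mem_cat xB ?orbT.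
have [U [UU FU]] := ultraFilterLemma FF.
exists (fun i => `[< U [set A | r A i] >]) => B X.
suff UX : U [set A : seq V | {in X, forall i, r A i = `[< U [set A | r A i] >]}].
  have UB : U [set A : seq V | {subset B <= A}] by apply: FU; exists B.
  by have [A [BA XA]] := filter_ex (filterI UB UX); exists A.
elim: X => [|i X IH].
  by apply: filterS filterT => A _ i; rewrite in_nil.
have Ui : U [set A | r A i = `[< U [set A | r A i] >]].
  have [Ui|Ui] := in_ultra_setVsetC [set A | r A i] UU.
    by rewrite (asboolT Ui).
  case: asboolP => [//|_].
  by apply: filterS Ui => A /= /negP/negbTE.
apply: filterS (filterI Ui IH) => A [/= rAi rAX] j.
by rewrite inE => /predU1P[->//|/rAX].
Qed.

Section Monoid.
Variables (V : choiceType) (E : rel V).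
Hypotheses (symE : symmetric E) (irrE : irreflexive E).
Hypothesis extE : forall (A : seq V) (P : pred V),
  exists2 v, v \notin A & {in A, E v =1 P}.
Variable e : nat -> V.
Hypothesis eS : forall v, exists n, e n = v.
Variable M : set (V -> V).
Hypotheses (M1 : M id) (MM : forall f g, M f -> M g -> M (f \o g)).
Hypothesis AutM : Aut E `<=` M.

Let homog := homogeneous symE irrE extE eS.

(* The position of A under g is one that M only moves reversibly. *)
Definition terminal_on (A : seq V) (g : V -> V) :=
  forall g', M g' -> exists2 g'', M g'' & {in A, forall x, g'' (g' (g x)) = g x}.

(** Choose [g] with the fewest types of [A] reachable from it. A further [g'] cannot lose any of
    them, so the type of [g] is still reachable, and homogeneity turns it into [g] itself on [A]. *)
Lemma exists_terminal (A : seq V) : exists2 g, M g & terminal_on A g.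
Proof.
pose typ g : {ffun seq_sub A * seq_sub A -> bool * bool} :=
  [ffun p => (g (val p.1) == g (val p.2), E (g (val p.1)) (g (val p.2)))].
pose R g := [set t | `[< exists2 h, M h & typ (h \o g) = t >]]%SET.
pose Q n := `[< exists2 g, M g & #|R g| = n >].
have exQ : exists n, Q n by exists #|R id|; apply/asboolP; exists id.
case: (ex_minnP exQ) => n /asboolP[g Mg <-] ming; exists g => // g' Mg'.
have sub : R (g' \o g) \subset R g.
  apply/fintype.subsetP => t; rewrite !finset.in_set => /asboolP[h Mh ht].
  by apply/asboolP; exists (h \o g') => //; exact: MM.
have /eqP RE : R (g' \o g) == R g.
  by rewrite eqEcard sub ming//; apply/asboolP; exists (g' \o g) => //; exact: MM.
have : typ g \in R g by rewrite finset.in_set; apply/asboolP; exists id.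
rewrite -RE finset.in_set => /asboolP[h Mh /ffunP ht].
have [|a Aa aP] := @homog A (h \o (g' \o g)) g.
  by move=> x y xA yA _; have := ht (SeqSub xA, SeqSub yA); rewrite !ffunE /= => -[-> ->].
by exists (a \o h) => //; apply: MM => //; exact: AutM.
Qed.

(* [None] stands for a collapse to a point, [Some b] for an injection onto a
   clique (b = true) or an independent set (b = false). *)
Definition canonical_on (k : option bool) (A : seq V) (g : V -> V) :=
  {in A &, forall x y, x <> y ->
    if k is Some b then g x <> g y /\ E (g x) (g y) = b else g x = g y}.

Lemma irreversible_canonical (s : seq V) (g0 : V -> V) (A : seq V) :
    M g0 -> (forall g, M g -> ~ {in s, cancel g0 g}) ->
  exists k, exists2 g, M g & canonical_on k A g.
Proof.
move=> Mg0 irr.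
have /choice[t tP] B : exists g, M g /\ terminal_on B g.
  by have [g ? ?] := exists_terminal B; exists g.
(* The flag [true] asks for equality of the two images, [false] for their adjacency. *)
pose r B (i : V * V * bool) :=
  if i.2 then t B i.1.1 == t B i.1.2 else E (t B i.1.1) (t B i.1.2).
have [r' r'P] := ultralimit r.
pose c x y := (r' (x, y, true), r' (x, y, false)).
have symc x y : c x y = c y x.
  have [B _ Bc] := r'P [::] [:: (x, y, true); (y, x, true); (x, y, false); (y, x, false)].
  by rewrite /c -!Bc ?inE ?eqxx ?orbT// /r /= eq_sym symE.
(* z serves as an apex: joined to all of A in the same way, it forces A to
   collapse as soon as phi collapses that kind of pair. *)
have [z zAs _] := extE (A ++ s) xpredT.
pose A' := undup (z :: A ++ s).
have [phi phiP] := canonical_copies symE extE symc (undup_uniq (z :: A ++ s)).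
have copy (F : rel V) : symmetric F -> exists i g, [/\ M g, terminal_on (map i A') g &
    {in A' &, forall x y, x <> y -> [/\ i x <> i y, E (i x) (i y) = F x y,
      (g (i x) == g (i y)) = (phi (F x y)).1 & E (g (i x)) (g (i y)) = (phi (F x y)).2]}].
  move=> symF; have [i iP] := phiP F symF; exists i.
  have [B A'B Bc] := r'P (map i A')
    [seq (p, b) | p <- [seq (i x, i y) | x <- A', y <- A'], b <- [:: true; false]].
  have [MB tB] := tP B; exists (t B); split=> //.
    move=> g' /tB[g'' Mg'' g''P]; exists g'' => // x /A'B; exact: g''P.
  move=> x y xA' yA' xy; have [ixy Exy cxy] := iP x y xA' yA' xy.
  have xyb b : (i x, i y, b) \in
      [seq (p, b) | p <- [seq (i x, i y) | x <- A', y <- A'], b <- [:: true; false]].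
    apply: allpairs_f; first exact: allpairs_f.
    by case: b; rewrite !inE.
  by rewrite -cxy /= -!Bc.
have AA' : {subset A <= A'} by move=> x xA; rewrite mem_undup inE mem_cat xA orbT.
have sA' : {subset s <= A'} by move=> x xs; rewrite mem_undup inE mem_cat xs !orbT.
have zA' : z \in A' by rewrite mem_undup mem_head.
have zA x : x \in A -> (x == z) = false.
  by move=> xA; apply: contraNF zAs => /eqP <-; rewrite mem_cat xA.
have [[b phib]|/forallNP noeq] := EM (exists b, (phi b).1).
  have [|i [g [Mg _ iP]]] := copy (fun x y => if (x == z) || (y == z) then b else E x y).
    by move=> x y; rewrite orbC symE.
  have [|a Aa aP] := @homog A id i.
    move=> x y xA yA xy; have [ixy -> _ _] := iP x y (AA' x xA) (AA' y yA) xy.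
    by rewrite !zA//; move/eqP/negbTE: xy => ->; move/eqP/negbTE: ixy => ->.
  exists None, (g \o a); first by apply: MM => //; exact: AutM.
  suff gz x : x \in A -> g (a x) = g (i z) by move=> x y xA yA _ /=; rewrite !gz.
  move=> xA; rewrite aP//; have /eqP xz := negbT (zA x xA).
  have [_ _ + _] := iP x z (AA' x xA) zA' xz.
  by rewrite eqxx orbT phib => /eqP.
have {}noeq b : (phi b).1 = false by apply/negP; exact: noeq.
have [phi_const|phi_diff] := eqVneq (phi true).2 (phi false).2.
  have [i [g [Mg _ iP]]] := copy E symE.
  have [|a Aa aP] := @homog A id i.
    move=> x y xA yA xy; have [ixy -> _ _] := iP x y (AA' x xA) (AA' y yA) xy.
    by move/eqP/negbTE: xy => ->; move/eqP/negbTE: ixy => ->.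
  exists (Some (phi true).2), (g \o a); first by apply: MM => //; exact: AutM.
  move=> x y xA yA xy /=; rewrite !aP//.
  have [_ _ + ->] := iP x y (AA' x xA) (AA' y yA) xy.
  by rewrite noeq => /negbT/eqP ?; split=> //; case: (E x y).
(* Here [(phi b).2] is [b (+) (phi false).2]. Twisting [E] by the same bit cancels it, so [g \o i]
   reproduces [E] on [s]. *)
have [|i [g [Mg tg iP]]] := copy (fun x y => E x y (+) (phi false).2).
  by move=> x y; rewrite symE.
have [|a Aa aP] := @homog s (g \o i) id.
  move=> x y xs ys xy /=; have [_ _ -> ->] := iP x y (sA' x xs) (sA' y ys) xy.
  rewrite noeq; move/eqP/negbTE: (xy) => ->; split=> //.
  move: phi_diff; case f2: (phi false).2; case t2: (phi true).2 => // _;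
  by case: (E x y); rewrite /= ?f2 ?t2.
(* As [a] sends [g (i x)] to [x], undoing [g0 \o a] at [g (i x)] amounts to inverting [g0] at
   [x]. *)
have [|g' Mg' g'P] := tg (g0 \o a); first by apply: MM => //; exact: AutM.
case: (irr (a \o g')); first by apply: MM => //; exact: AutM.
move=> x xs; have /= aix := aP x xs.
by have := g'P _ (map_f i (sA' x xs)); rewrite /= aix => ->.
Qed.

(** Canonicity passes to sublists, so bad lists for the three values of [k] would concatenate into
    one bad for all. *)
Lemma irreversible_cases (s : seq V) (g0 : V -> V) :
    M g0 -> (forall g, M g -> ~ {in s, cancel g0 g}) ->
  exists k, forall A, exists2 g, M g & canonical_on k A g.
Proof.
move=> Mg0 irr; apply: contrapT => /forallNP no.
have ex k : exists A, forall g, M g -> ~ canonical_on k A g.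
  have /existsNP[A /forall2NP noA] := no k; exists A => g Mg.
  by case: (noA g).
have [B BP] := choice ex.
have [k [g Mg gk]] := irreversible_canonical (flatten (map B (enum {: option bool}))) Mg0 irr.
apply: (BP k g Mg) => x y xB yB; apply: gk; apply/flatten_mapP; exists k => //; exact: mem_enum.
Qed.

End Monoid.

(** * The random graph *)

Lemma random_graph_extension (V : choiceType) (E : rel V) :
  random_graph E -> forall (A : seq V) (P : pred V),
    exists2 v, v \notin A & {in A, E v =1 P}.
Proof.
move=> [_ _ _ ext] A P.
have finA (Q : pred V) : finite_set [set x | x \in A /\ Q x].
  by apply: sub_finite_set (finite_seq A) => x [].
have [|v [vA EU EU']] := ext _ _ (finA P) (finA (predC P)).
  by rewrite -subset0 => x [[_ Px] [_ /negP]].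
exists v.
  by apply/negP => vA'; apply: vA; case: (boolP (P v)) => Pv; [left | right].
move=> x xA; case: (boolP (P x)) => Px; first exact: EU.
by apply/negbTE/EU'.
Qed.

Lemma random_graph_enum (V : Type) (E : rel V) :
  random_graph E -> exists e : nat -> V, forall v, exists n, e n = v.
Proof.
move=> [/card_set_bijP[f] + _ _ _]; rewrite setTT_bijective => -[e eK _].
by exists e => v; exists (f v).
Qed.

Unset Implicit Arguments.
Theorem theorem1 (V : Type) (E : rel V) (hG : random_graph E)
    (eE : V -> V) (eE_inj : injective eE) (eE_clique : infinite_clique E (range eE))
    (eN : V -> V) (eN_inj : injective eN)
    (eN_indep : infinite_independent_set E (range eN))
    (M : set (V -> V)) (hM : locally_closed_monoid M) (hAut : Aut E `<=` M) :
  [\/ exists c : V, M (cst c),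
      M eE,
      M eN |
      M = generated_monoid (M `&` all_permutations V)].
Proof.
move: E hG eE eE_inj eE_clique eN eN_inj eN_indep M hM hAut.
(* The bare type receives a choice structure, so that lists can stand for finite sets. *)
elim/Pchoice: V => V E hG eE eE_inj [_ eE_adj] eN eN_inj [_ eN_adj] M hM hAut.
have extE := random_graph_extension hG.
have [e eS] := random_graph_enum hG.
have [_ symE irrE _] := hG.
have [[M1 MM] MC] := hM.
have homog := homogeneous symE irrE extE eS.
have [rev|] := EM (forall (s : seq V) g, M g -> exists2 g', M g' & {in s, cancel g g'}).
  by apply: Or44; exact: reversible_generated.
move=> /existsNP[s] /existsNP[g0] /not_implyP[Mg0 /forall2NP irr].
have {}irr g : M g -> ~ {in s, cancel g0 g} by move=> Mg; case: (irr g).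
have [[b|] canM] := irreversible_cases symE irrE extE eS M1 MM hAut Mg0 irr.
- have Mb (f : V -> V) : injective f -> (forall x y, x <> y -> E (f x) (f y) = b) -> M f.
    move=> f_inj fE; apply: MC => _ /finite_seqP[A ->].
    have [g Mg gA] := canM A.
    (* On [A], both [g] and [f] are injections onto cliques, or both onto independent sets, so an
       automorphism matches them. *)
    have [|a Aa aP] := homog A g f.
      move=> x y xA yA xy; have [/eqP/negbTE-> ->] := gA x y xA yA xy.
      by rewrite fE// (inj_eq f_inj); move/eqP/negbTE: xy => ->.
    by exists (a \o g); [apply: MM => //; exact: hAut | exact: aP].
  case: b {canM} Mb => Mb; [apply: Or42 | apply: Or43]; apply: Mb => // x y xy.
    by apply: eE_adj; [exists x | exists y | move=> /eE_inj].
  by apply/negbTE/eN_adj; [exists x | exists y].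
- have [v _ _] := extE [::] xpredT; apply: Or41; exists v.
  apply: MC => _ /finite_seqP[A ->]; have [g Mg gA] := canM A.
  have [|a Aa aP] := homog A g (cst v).
    by move=> x y xA yA xy /=; rewrite (gA x y xA yA xy) !eqxx !irrE.
  by exists (a \o g); [apply: MM => //; exact: hAut | exact: aP].
Qed.
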